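(* The isomorphism relation on the space of center-by-metabelian, finitely generated, marked groups is not smooth.
   Context: A group $G$ is center-by-metabelian if $G/Z(G)$ is metabelian. The space of finitely generated marked groups. An $n$-generated marked group is a pair $(G,(a_1,\dots,a_n))$ where $G$ is a group generated by $a_1,\dots,a_n$; two such pairs $(G,(a_i))$, $(H,(b_i))$ are identified if $a_i\mapsto b_i$ extends to an isomorphism $G\to H$. Let $\mathcal G_n$ be the set of all $n$-generated marked groups. With $F_n$ free on $x_1,\dots,x_n$, the map sending $(G,(a_i))$ to the kernel of the epimorphism $F_n\to G$, $x_i\mapsto a_i$, is a bijection from $\mathcal G_n$ to the set of normal subgroups of $F_n$; the latter has the subspace topology from $2^{F_n}$ (product topology), and $\mathcal G_n$ has the pulled-back topology. The map $(G,(a_1,\dots,a_n))\mapsto(G,(a_1,\dots,a_n,1))$ is a continuous embedding $\mathcal G_n\to\mathcal G_{n+1}$, and $\mathcal G=\bigcup_n\mathcal G_n$ with the topological union topology. The space in question is the subspace of $\mathcal G$ consisting of marked groups $(G,X)$ with $G$ center-by-metabelian; the isomorphism relation on it is $(G,X)\sim(H,Y)\iff G\cong H$. An equivalence relation $E$ on a topological space $X$ is smooth if there are a Polish space $P$ and a Borel map $\beta:X\to P$ such that for all $x,y\in X$, $xEy\iff\beta(x)=\beta(y)$. *)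

(* Defs.v *)
From HB Require Import structures.
From mathcomp Require Import all_boot all_order all_algebra.
From mathcomp Require Import all_classical all_reals all_analysis.

Set Implicit Arguments.
Unset Strict Implicit.
Unset Printing Implicit Defensive.

Local Open Scope classical_set_scope.
Local Open Scope group_scope.

(* The letter (i, false) stands for the generator x_i and (i, true) for its
   inverse. *)

Section Words.
Variable I : choiceType.
Implicit Types (a b : I * bool) (u v w : seq (I * bool)).

Definition letter_inv a := (a.1, ~~ a.2).

Definition reduced w := sorted (fun a b => b != letter_inv a) w.

Definition push a w :=
  if w is b :: w' then if b == letter_inv a then w' else a :: w else [:: a].

Definition word_mul u v := foldr push v u.

Definition word_inv w := rev (map letter_inv w).

Lemma letter_invK : involutive letter_inv.
Proof. by case=> i s; rewrite /letter_inv /= negbK. Qed.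

Lemma reduced_tail a w : reduced (a :: w) -> reduced w.
Proof. by case: w => //= b w /andP[]. Qed.

Lemma push_reduced a w : reduced w -> reduced (push a w).
Proof.
case: w => [|b w] //= rw; case: eqVneq => [_|nba]; first exact: reduced_tail rw.
by rewrite /= nba.
Qed.

Lemma word_mul_reduced u v : reduced v -> reduced (word_mul u v).
Proof. by move=> rv; elim: u => //= a u; exact: push_reduced. Qed.

Lemma pushK a w : reduced w -> push a (push (letter_inv a) w) = w.
Proof.
case: w => [|b w] /=; first by rewrite eqxx.
rewrite letter_invK; case: eqVneq => [-> rw|nba _]; last by rewrite /= eqxx.
by case: w rw => [|c w] //= /andP[/negPf-> _].
Qed.

Lemma word_mul_push a u v : reduced v ->
  word_mul (push a u) v = push a (word_mul u v).
Proof.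
move=> rv; case: u => [|b u] //=; case: eqVneq => [->|//].
by rewrite pushK// word_mul_reduced.
Qed.

Lemma word_mulA u v w : reduced w ->
  word_mul u (word_mul v w) = word_mul (word_mul u v) w.
Proof. by move=> rw; elim: u => //= a u ->; rewrite word_mul_push. Qed.

Lemma word_mulw0 w : reduced w -> word_mul w [::] = w.
Proof.
elim: w => //= a w IHw raw; rewrite IHw; last exact: reduced_tail raw.
by case: w raw {IHw} => //= b w /andP[/negPf->].
Qed.

Lemma word_invK : involutive word_inv.
Proof. by move=> w; rewrite /word_inv map_rev revK mapK//; exact: letter_invK. Qed.

Lemma word_inv_reduced w : reduced w -> reduced (word_inv w).
Proof.
rewrite /reduced /word_inv rev_sorted sorted_map; apply: sub_sorted => a b /=.
by apply: contraNneq => ->; rewrite letter_invK.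
Qed.

Lemma word_mulVw w : reduced w -> word_mul (word_inv w) w = [::].
Proof.
elim: w => //= a w IHw raw; have rw := reduced_tail raw.
rewrite /word_inv /= rev_cons /word_mul foldr_rcons /= letter_invK eqxx.
exact: IHw.
Qed.

Record free_group := FreeGroup { word : seq (I * bool); _ : reduced word }.

HB.instance Definition _ := [isSub for word].
HB.instance Definition _ := [Choice of free_group by <:].

Implicit Types x y z : free_group.

Definition fg_one := @FreeGroup [::] isT.
Definition fg_mul x y :=
  FreeGroup (word_mul_reduced (word x) (valP y : reduced (word y))).
Definition fg_inv x := FreeGroup (word_inv_reduced (valP x)).

Lemma fg_mulA : associative fg_mul.
Proof. by move=> x y z; apply/val_inj/word_mulA/valP. Qed.
Lemma fg_mul1g : left_id fg_one fg_mul.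
Proof. by move=> x; apply/val_inj. Qed.
Lemma fg_mulg1 : right_id fg_one fg_mul.
Proof. by move=> x; apply/val_inj/word_mulw0/valP. Qed.
Lemma fg_mulVg : left_inverse fg_one fg_inv fg_mul.
Proof. by move=> x; apply/val_inj/word_mulVw/valP. Qed.
Lemma fg_mulgV : right_inverse fg_one fg_inv fg_mul.
Proof.
move=> x; apply/val_inj; rewrite /= -{1}[word x]word_invK.
exact/word_mulVw/word_inv_reduced/valP.
Qed.

HB.instance Definition _ :=
  isGroup.Build free_group fg_mulA fg_mul1g fg_mulg1 fg_mulVg fg_mulgV.

Definition fg_gen (i : I) : free_group := @FreeGroup [:: (i, false)] isT.

Definition fg_lift (G : groupType) (a : I -> G) x : G :=
  foldr (fun l g => (if l.2 then (a l.1)^-1 else a l.1) * g) 1 (word x).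

Lemma fg_lift_gen (G : groupType) (a : I -> G) i : fg_lift a (fg_gen i) = a i.
Proof. exact: mulg1. Qed.

Lemma fg_liftM (G : groupType) (a : I -> G) :
  {morph fg_lift a : x y / x * y}.
Proof.
move=> x y; rewrite /fg_lift /=.
set ev := foldr _ 1; elim: (word x) => [|l u IHu] /=; first by rewrite mul1g.
rewrite -mulgA -IHu; case: (word_mul u _) => [|m w] //=.
case: eqVneq => [->|//] /=; case: l => i [] /=.
  by rewrite mulKg.
by rewrite mulVKg.
Qed.

HB.instance Definition _ (G : groupType) (a : I -> G) :=
  isUMagmaMorphism.Build free_group G (fg_lift a) (erefl, fg_liftM a).

Lemma fg_lift_comp (G H : groupType) (f : UMagmaMorphism.type G H)
    (a : I -> G) x : f (fg_lift a x) = fg_lift (f \o a) x.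
Proof.
rewrite /fg_lift; elim: (word x) => [|l w IHw] /=; first exact: gmulf1.
by rewrite gmulfM IHw; case: l.2; rewrite ?gmulfV.
Qed.

Lemma fg_lift_id x : fg_lift fg_gen x = x.
Proof.
apply/val_inj; rewrite /fg_lift /=; case: x => w /= rw.
elim: w rw => [|[i s] w IHw] rw; first by [].
rewrite [foldr _ _ _]/=; have {IHw} := IHw (reduced_tail rw); set y := foldr _ _ w => yw.
have -> : word ((if s then (fg_gen i)^-1 else fg_gen i) * y) =
          push (i, s) (word y) by case: s {rw}.
by rewrite yw; case: w rw {y yw} => //= b w /andP[/negPf->].
Qed.

End Words.

Definition isomorphic (G H : groupType) : Prop :=
  exists f : {multiplicative G -> H}, bijective f.

(* Subsets of G are points of 2^G, which carries the product topology. *)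
Definition normal_subgroup (G : groupType) :
    set (prod_topology (fun _ : G => bool)) :=
  [set N | group_closed (N : {pred G}) /\ forall x y : G, N x -> N (x ^ y)].

Arguments normal_subgroup : clear implicits.

Section QuotientGroup.
Variables (G : groupType) (N : normal_subgroup G).
Implicit Types x y z : G.

Let inN : G -> bool := \val N.

Let N1 : inN 1. Proof. by have [[]] := set_mem (valP N). Qed.
Let NF x y : inN x -> inN y -> inN (x / y).
Proof. by have [[_ NF] _] := set_mem (valP N); exact: NF. Qed.
Let NJ x y : inN x -> inN (x ^ y).
Proof. by have [_] := set_mem (valP N); apply. Qed.
Let NV x : inN x -> inN x^-1.
Proof. by move=> Nx; rewrite -[x^-1]mul1g; exact: NF. Qed.
Let NM x y : inN x -> inN y -> inN (x * y).
Proof. by move=> Nx Ny; rewrite -[y]invgK; exact/NF/NV. Qed.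

Definition coset_eq x y := inN (x^-1 * y).

Lemma coset_eq_refl : reflexive coset_eq.
Proof. by move=> x; rewrite /coset_eq mulVg. Qed.
Lemma coset_eq_sym : symmetric coset_eq.
Proof.
by move=> x y; apply/idP/idP => /NV; rewrite /coset_eq invgM invgK.
Qed.
Lemma coset_eq_trans : transitive coset_eq.
Proof.
move=> y x z xy yz; rewrite /coset_eq.
by rewrite -[z](mulVKg y) mulgA; exact: NM.
Qed.

Definition coset_equiv :=
  EquivRel coset_eq coset_eq_refl coset_eq_sym coset_eq_trans.

Definition quotient_group := {eq_quot coset_equiv}%qT.

HB.instance Definition _ := Choice.on quotient_group.

Definition quotient_pi (x : G) : quotient_group :=
  (\pi_({eq_quot coset_equiv}) x)%qT.

Implicit Types u v w : quotient_group.

Lemma quotient_pi_eq x y : quotient_pi x = quotient_pi y <-> inN (x^-1 * y).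
Proof. by split => [/eqmodP|e]; [|apply/eqmodP]. Qed.

Lemma quotient_pi_surj u : exists x, u = quotient_pi x.
Proof. by exists (repr u); rewrite /quotient_pi reprK. Qed.

Definition quotient_mul u v := quotient_pi (repr u * repr v).
Definition quotient_inv u := quotient_pi (repr u)^-1.

Lemma repr_pi x : inN ((repr (quotient_pi x))^-1 * x).
Proof. by apply/quotient_pi_eq; rewrite /quotient_pi reprK. Qed.

Lemma quotient_piM x y :
  quotient_pi (x * y) = quotient_mul (quotient_pi x) (quotient_pi y).
Proof.
apply/esym/quotient_pi_eq; rewrite invgM.
have -> : forall r s, s^-1 * r^-1 * (x * y) = (s^-1 * y) * ((r^-1 * x) ^ y).
  by move=> r s; rewrite /conjg !mulgA mulgK.
by apply: NM; [|apply: NJ]; exact: repr_pi.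
Qed.

Lemma quotient_piV x : quotient_pi x^-1 = quotient_inv (quotient_pi x).
Proof.
apply/quotient_pi_eq; rewrite invgK.
have -> : forall r, x * r^-1 = (r^-1 * x) ^ x^-1.
  by move=> r; rewrite /conjg invgK mulgK.
exact/NJ/repr_pi.
Qed.

Lemma quotient_mulA : associative quotient_mul.
Proof.
move=> u v w; have [[x ->] [y ->] [z ->]] :=
  And3 (quotient_pi_surj u) (quotient_pi_surj v) (quotient_pi_surj w).
by rewrite -!quotient_piM mulgA.
Qed.
Lemma quotient_mul1g : left_id (quotient_pi 1) quotient_mul.
Proof.
by move=> u; have [x ->] := quotient_pi_surj u; rewrite -quotient_piM mul1g.
Qed.
Lemma quotient_mulg1 : right_id (quotient_pi 1) quotient_mul.
Proof.
by move=> u; have [x ->] := quotient_pi_surj u; rewrite -quotient_piM mulg1.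
Qed.
Lemma quotient_mulVg : left_inverse (quotient_pi 1) quotient_inv quotient_mul.
Proof.
move=> u; have [x ->] := quotient_pi_surj u.
by rewrite -quotient_piV -quotient_piM mulVg.
Qed.
Lemma quotient_mulgV : right_inverse (quotient_pi 1) quotient_inv quotient_mul.
Proof.
move=> u; have [x ->] := quotient_pi_surj u.
by rewrite -quotient_piV -quotient_piM mulgV.
Qed.

HB.instance Definition _ := isGroup.Build quotient_group
  quotient_mulA quotient_mul1g quotient_mulg1 quotient_mulVg quotient_mulgV.

HB.instance Definition _ :=
  isUMagmaMorphism.Build G quotient_group quotient_pi (erefl, quotient_piM).

End QuotientGroup.

Section CenterByMetabelian.
Variable G : groupType.

Definition subgroup_closure (S : set G) : set G :=
  smallest (fun H : set G => group_closed [in H]) S.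

Definition derived_subgroup : set G :=
  subgroup_closure [set g | exists x y : G, g = [~ x, y]].

Definition metabelian : Prop :=
  forall x y : G, derived_subgroup x -> derived_subgroup y -> commute x y.

Definition center_pred (x : G) : bool := `[< forall y : G, commute x y >].

Lemma center_normal : normal_subgroup G center_pred.
Proof.
have cP x : reflect (forall y : G, commute x y) (center_pred x) by exact: asboolP.
split; first split.
- by apply/cP => y; rewrite /commute mul1g mulg1.
- move=> x y /cP cx /cP cy; apply/cP => z; apply/commute_sym/commuteM.
    exact/commute_sym/cx.
  exact/commuteV/commute_sym/cy.
- by move=> x y /cP cx; apply/cP => z; rewrite /conjg cx mulKg; exact: cx.
Qed.

Definition center : normal_subgroup G := SigSub (mem_set center_normal).

End CenterByMetabelian.

Arguments metabelian : clear implicits.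
Arguments center : clear implicits.

Definition center_by_metabelian (G : groupType) : Prop :=
  metabelian (quotient_group (center G)).

Definition generates (G : groupType) n (a : 'I_n -> G) : Prop :=
  subgroup_closure (range a) = [set: G].

Section MarkingKernel.
Variables (G : groupType) (n : nat) (a : 'I_n -> G).

Definition marking_ker_pred (w : free_group 'I_n) : bool := fg_lift a w == 1.

Lemma marking_ker_normal : normal_subgroup (free_group 'I_n) marking_ker_pred.
Proof.
rewrite /marking_ker_pred; split; first split.
- exact/eqP.
- by move=> v w /eqP v1 /eqP w1; apply/eqP; rewrite gmulfF/= v1 w1 mulgV.
- by move=> v w /eqP v1; apply/eqP; rewrite gmulfJ/= v1 conj1g.
Qed.

End MarkingKernel.

(* An n-generated marked group, up to the identification of marked groups, is
   represented by the normal subgroup it determines in the free group of rank n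
   (see [marking_kerP] and [marking_ker_quotient]). The coercion from sets to
   types provides the topology induced by that of 2^F. *)
Definition marked_group (n : nat) : topologicalType :=
  normal_subgroup (free_group 'I_n).

Definition marking_ker (G : groupType) n (a : 'I_n -> G) : marked_group n :=
  SigSub (mem_set (marking_ker_normal a)).

Definition marked_quotient n (N : marked_group n) : groupType :=
  quotient_group N.

Definition marked_gen n (N : marked_group n) (i : 'I_n) : marked_quotient N :=
  quotient_pi N (fg_gen i).

(* (G, (a_1, ..., a_n)) |-> (G, (a_1, ..., a_n, 1)) *)
Definition marked_extend n (N : marked_group n) : marked_group n.+1 :=
  marking_ker (fun i => if unlift ord_max i is Some j then marked_gen N j else 1).

Lemma fg_lift_surj (G : groupType) n (a : 'I_n -> G) :
  generates a -> forall g, exists w, fg_lift a w = g.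
Proof.
move=> ga g; suff : subgroup_closure (range a) `<=` range (fg_lift a).
  by rewrite ga => /(_ g I)[w _ <-]; exists w.
apply: smallest_sub; last by move=> _ [i _ <-]; exists (fg_gen i); rewrite ?fg_lift_gen.
split; first by apply/mem_set; exists 1; rewrite ?gmulf1.
move=> _ _ /set_mem[v _ <-] /set_mem[w _ <-]; apply/mem_set.
by exists (v / w); rewrite ?gmulfF.
Qed.

Lemma marking_kerP (G H : groupType) n (a : 'I_n -> G) (b : 'I_n -> H) :
  generates a -> generates b ->
  marking_ker a = marking_ker b <->
  exists2 f : {multiplicative G -> H}, bijective f & forall i, f (a i) = b i.
Proof.
move=> /fg_lift_surj sa /fg_lift_surj sb; split=> [/(congr1 val)/= eab|]; last first.
  move=> [f bf fab]; apply/val_inj/funext => w; rewrite /= /marking_ker_pred.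
  have f1 : f 1 = 1 by apply/(mulgI (f 1)); rewrite -gmulfM !mulg1.
  pose f' : UMagmaMorphism.type G H := HB.pack_for (UMagmaMorphism.type G H)
    (Multiplicative.sort f) (isUMagmaMorphism.Build G H f (f1, @gmulfM _ _ f)).
  have -> : fg_lift b w = f' (fg_lift a w).
    by rewrite fg_lift_comp; congr fg_lift; apply/funext => i; rewrite -fab.
  rewrite -[LHS](inj_eq (bij_inj bf)) f1; exact: erefl.
have key v w : fg_lift a v = fg_lift a w <-> fg_lift b v = fg_lift b w.
  have E (K : groupType) (c : 'I_n -> K) :
      fg_lift c v = fg_lift c w <-> marking_ker_pred c (v / w).
    rewrite /marking_ker_pred gmulfF /=; split=> [->|/eqP e]; first by rewrite mulgV.
    by rewrite -[LHS](mulgVK (fg_lift c w)) e mul1g.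
  by rewrite !E eab.
pose s g := projT1 (cid (sa g)); pose t h := projT1 (cid (sb h)).
have sK g : fg_lift a (s g) = g := projT2 (cid (sa g)).
have tK h : fg_lift b (t h) = h := projT2 (cid (sb h)).
pose f g := fg_lift b (s g).
have fM : {morph f : x y / x * y}.
  move=> x y; rewrite /f -fg_liftM; apply: (key _ _).1.
  by rewrite fg_liftM !sK.
exists (HB.pack_for {multiplicative G -> H} f (isMultiplicative.Build G H f fM)).
  exists (fun h => fg_lift a (t h)) => [g|h] /=.
    by rewrite -[RHS]sK; apply: (key _ _).2; rewrite tK.
  by rewrite -[RHS]tK; apply: (key _ _).1; rewrite sK.
by move=> i; rewrite -(fg_lift_gen b); apply: (key _ _).1; rewrite sK fg_lift_gen.
Qed.

Lemma fg_lift_marked_gen n (N : marked_group n) w :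
  fg_lift (marked_gen N) w = quotient_pi N w.
Proof. by rewrite -[in RHS](fg_lift_id w) fg_lift_comp. Qed.

Lemma marking_ker_quotient n (N : marked_group n) :
  marking_ker (marked_gen N) = N.
Proof.
apply/val_inj/funext => w; rewrite /= /marking_ker_pred fg_lift_marked_gen.
apply/eqP/idP => [/esym/quotient_pi_eq|Nw]; first by rewrite invg1 mul1g.
by apply/esym/quotient_pi_eq; rewrite invg1 mul1g.
Qed.

Lemma subgroup_closureP (G : groupType) (S : set G) :
  group_closed [in subgroup_closure S].
Proof.
split; first by apply/mem_set => H [[H1 _] _]; exact: set_mem H1.
move=> x y /set_mem Sx /set_mem Sy; apply/mem_set => H /[dup] HS [[_ HF] _].
by apply: set_mem; apply: HF; apply/mem_set; [exact: Sx|exact: Sy].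
Qed.

Lemma marked_gen_generates n (N : marked_group n) : generates (marked_gen N).
Proof.
apply/seteqP; split=> // u _; have [w ->] := quotient_pi_surj u.
rewrite -fg_lift_marked_gen /fg_lift.
have gM := group_closedM (subgroup_closureP (range (marked_gen N))).
have gV := group_closedV (subgroup_closureP (range (marked_gen N))).
have [g1 _] := subgroup_closureP (range (marked_gen N)).
apply/set_mem; elim: (word w) => //= l v IHv; apply: gM => //.
have gi : marked_gen N l.1 \in subgroup_closure (range (marked_gen N)).
  by apply/mem_set; apply: sub_gen_smallest; exists l.1.
by case: l.2 => //; exact: gV.
Qed.

Definition marked_sum : topologicalType := {n : nat & marked_group n}.

Definition marked_step (p : marked_sum) : marked_sum :=
  existT _ (projT1 p).+1 (marked_extend (projT2 p)).

(* The equivalence relation generated by p ~ marked_step p *)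
Definition marked_eq (p q : marked_sum) : bool :=
  `[< exists k l, iter k marked_step p = iter l marked_step q >].

Lemma marked_eq_refl : reflexive marked_eq.
Proof. by move=> p; apply/asboolP; exists 0%N, 0%N. Qed.
Lemma marked_eq_sym : symmetric marked_eq.
Proof. by move=> p q; apply/asboolP/asboolP => -[k [l e]]; exists l, k. Qed.
Lemma marked_eq_trans : transitive marked_eq.
Proof.
move=> q p r /asboolP[k [l pq]] /asboolP[k' [l' qr]]; apply/asboolP.
exists (k' + k)%N, (l + l')%N.
by rewrite !iterD pq -qr -!iterD addnC.
Qed.

Definition marked_equiv :=
  EquivRel marked_eq marked_eq_refl marked_eq_sym marked_eq_trans.

(* The union of the marked_group n along the embeddings marked_extend: the
   quotient topology of the sum topology is the union topology. *)
Definition marked_groups : topologicalType :=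
  quotient_topology {eq_quot marked_equiv}%qT.

(* The isomorphism type does not depend on the representative
   (see [group_of_pi]). *)
Definition group_of (x : marked_groups) : groupType :=
  marked_quotient (projT2 (repr x)).

Lemma isomorphic_sym (G H : groupType) : isomorphic G H -> isomorphic H G.
Proof.
move=> [f [g fK gK]]; have gM : {morph g : x y / x * y}.
  by move=> x y; apply: (can_inj fK); rewrite gmulfM !gK.
by exists (HB.pack_for {multiplicative H -> G} g (isMultiplicative.Build H G g gM)); exists f.
Qed.

Lemma isomorphic_trans (G H K : groupType) :
  isomorphic G H -> isomorphic H K -> isomorphic G K.
Proof. by move=> [f bf] [g bg]; exists (g \o f); exact: bij_comp. Qed.

Lemma marked_extend_iso n (N : marked_group n) :
  isomorphic (marked_quotient N) (marked_quotient (marked_extend N)).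
Proof.
set b := fun i : 'I_n.+1 => if unlift ord_max i is Some j then marked_gen N j else 1.
have gb : generates b.
  apply/seteqP; split=> // u _; rewrite -[_ u]/(subgroup_closure _ u).
  have : subgroup_closure (range (marked_gen N)) u by rewrite marked_gen_generates.
  apply: sub_smallest2r; first exact: subgroup_closureP.
  by move=> _ [i _ <-]; exists (lift ord_max i) => //; rewrite /b liftK.
have [] := marking_kerP gb (marked_gen_generates (marked_extend N)).
by rewrite marking_ker_quotient => /(_ erefl)[f bf _] _; exists f.
Qed.

Lemma group_of_pi (p : marked_sum) :
  isomorphic (group_of (\pi_marked_groups p)%qT) (marked_quotient (projT2 p)).
Proof.
have iter_iso k q : isomorphic (marked_quotient (projT2 q))
    (marked_quotient (projT2 (iter k marked_step q))).
  elim: k => [|k IHk]; first by exists idfun; exists idfun.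
  exact/(isomorphic_trans IHk)/marked_extend_iso.
have /eqmodP/asboolP[k [l e]] : (repr (\pi_marked_groups p) = p %[mod_eq marked_equiv])%qT.
  exact: reprK.
by apply: isomorphic_trans (iter_iso k _) _; rewrite e; exact/isomorphic_sym/iter_iso.
Qed.

Definition complete_space (T : uniformType) : Prop :=
  forall F : set_system T, ProperFilter F -> cauchy F -> exists x : T, F --> x.

Definition separable_space (T : topologicalType) : Prop :=
  exists2 D : set T, countable D & dense D.

Definition borel_map (T U : topologicalType) (f : T -> U) : Prop :=
  forall B, <<s (@open U) >> B -> <<s (@open T) >> (f @^-1` B).

(* The Polish space P comes with one of its compatible complete metrics, of which
   [borel_map] only uses the topology. *)
Definition smooth (R : realType) (T : topologicalType) (E : T -> T -> Prop) :
    Prop :=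
  exists P : metricType R, [/\ complete_space P, separable_space P &
    exists2 f : T -> P, borel_map f & forall x y, E x y <-> f x = f y].

Definition cbm_groups : set marked_groups :=
  [set x | center_by_metabelian (group_of x)].

Definition isomorphism_on (S : set marked_groups) (x y : S) : Prop :=
  isomorphic (group_of (\val x)) (group_of (\val y)).

(* Main.v *)
From HB Require Import structures.
Require Import Defs.
From mathcomp Require Import all_boot all_order all_algebra.
From mathcomp Require Import all_classical all_reals all_analysis.
From mathcomp Require Import lra zify.

(** Write c for a point of the Cantor space of binary sequences, extended by 0
    to the negative integers. Let G_c be the group of permutations of
    (F_2 ^ Z) x F_2 generated by
      t : (v, w) |-> (v shifted by one, w),    e : (v, w) |-> (v + delta_0, w),
      f : (v, w) |-> (v, w + v_0),             b : (v, w) |-> (v + c, w).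
    The non-smoothness comes from the family of the G_c, for three reasons.

    The groups are center-by-metabelian. Each element acts by
    (v, w) |-> ((v shifted by k) + m, w + q(v)) with q affine, so commutators
    have k = 0; and two elements with k = 0 commute up to adding a constant to w,
    which is a central permutation ([commutator_vertical]).

    Changing c at finitely many places does not change G_c, as a set of
    permutations: the conjugates of e by powers of t are the translations by the
    delta_n, so they correct b ([marked_family_flip]).

    On the other hand b commutes with the conjugate of f by t^n exactly when
    c_n = 0, so the marked group (G_c, (t, e, f, b)) determines c
    ([marked_family_inj]). A countable group has countably many generating
    quadruples, hence countably many c give a group isomorphic to a fixed one
    ([isomorphic_family_meager]).

    The map from c to the marked group G_c pulls Borel sets back to sets with the
    Baire property ([cbm_family_baire]), because a given word is trivial in G_c
    for a closed set of c. A Borel map deciding isomorphism would therefore give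
    a function on the Cantor space with values in a separable metric space, with
    the Baire property, and invariant under finite changes. By the topological
    zero-one law such a function is constant on a comeager set
    ([generically_constant]); this comeager set would lie in one isomorphism
    class, which is countable, against the Baire category theorem. *)

Set Implicit Arguments.
Unset Strict Implicit.
Unset Printing Implicit Defensive.

Import Order.TTheory GRing.Theory Num.Theory.

Local Open Scope classical_set_scope.
Local Open Scope group_scope.

(** * Comeager sets and the Baire property *)

Definition comeager (T : topologicalType) : set_system T :=
  [set A | exists2 U : nat -> set T,
     forall n, open (U n) /\ dense (U n) & \bigcap_n U n `<=` A].

Definition baire_space (T : topologicalType) : Prop :=
  forall A : set T, comeager A -> dense A.

Definition baire_property (T : topologicalType) (A : set T) : Prop :=
  exists2 U, open U & \forall x \near @comeager T, A x <-> U x.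

Section Comeager.
Variable T : topologicalType.
Implicit Types (A B U V : set T).

Lemma denseT : dense [set: T].
Proof. by move=> U [x Ux] _; exists x. Qed.

Lemma comeager_open_dense U : open U -> dense U -> comeager U.
Proof. by move=> oU dU; exists (fun=> U) => // x /(_ 0%N I). Qed.

Lemma comeager_forall (J : countType) (P : J -> set T) :
  (forall j, comeager (P j)) -> comeager [set x | forall j, P j x].
Proof.
move=> /(_ _)/cid2-/all_sig2[U oU UP].
pose V m := if @unpickle (J * nat)%type m is Some jn then U jn.1 jn.2 else setT.
exists V => [m|x Vx j].
  rewrite /V; case: unpickle => [jn|]; first exact: oU.
  by split; [exact: openT|exact: denseT].
by apply: UP => n _; have := Vx (pickle (j, n)) I; rewrite /V pickleK.
Qed.

Global Instance comeager_filter : Filter (@comeager T).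
Proof.
split.
- by apply: comeager_open_dense; [exact: openT|exact: denseT].
- move=> A B cA cB; have := @comeager_forall bool (fun b => if b then A else B).
  case=> [[]//|U oU UAB]; exists U => // x /UAB cx.
  by split; [exact: cx true|exact: cx false].
- by move=> A B AB [U oU UA]; exists U => //; exact: subset_trans AB.
Qed.

Lemma baire_property_open U : open U -> baire_property U.
Proof. by move=> oU; exists U => //; exact: nearW. Qed.

(** The boundary of an open set is nowhere dense, so the complement of an open
    set is open up to a meager set. *)
Lemma baire_propertyC A : baire_property A -> baire_property (~` A).
Proof.
move=> [U oU AU]; exists (~` U)°; first exact: open_interior.
have bU : comeager (U `|` (~` U)°).
  apply: comeager_open_dense; first exact/openU/open_interior.
  move=> V [x Vx] oV; have [[y [Vy Uy]]|VU] := pselect (V `&` U !=set0).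
    by exists y; split=> //; left.
  exists x; split=> //; right; apply: filterS (open_nbhs_nbhs (conj oV Vx)).
  by move=> y Vy Uy; apply: VU; exists y.
near=> x; have Ax : A x <-> U x by near: x.
have Ux : (U `|` (~` U)°) x by near: x.
split=> [nA|/interior_subset nU]; last by rewrite /= Ax.
by case: Ux => // /Ax.
Unshelve. all: by end_near. Qed.

Lemma baire_property_exists (J : countType) (P : J -> set T) :
  (forall j, baire_property (P j)) -> baire_property [set x | exists j, P j x].
Proof.
move=> /(_ _)/cid2-/all_sig2[U oU PU]; exists (\bigcup_j U j).
  exact: bigcup_open.
apply: filterS (comeager_forall PU) => x Px.
by split=> [[j /Px]|[j _ /Px]]; exists j.
Qed.

Lemma baire_property_forall (J : countType) (P : J -> set T) :
  (forall j, baire_property (P j)) -> baire_property [set x | forall j, P j x].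
Proof.
move=> bP; rewrite (_ : mkset _ = ~` [set x | exists j, (~` P j) x]).
  by apply/baire_propertyC/baire_property_exists => j; exact/baire_propertyC.
apply/seteqP; split=> x /= Px; first by case=> j; apply; exact: Px.
by move=> j; apply: contrapT => nP; apply: Px; exists j.
Qed.

(** If A and its complement were both nonmeager, they would agree generically
    with nonempty open sets U and W; some g i moves a point of U into W, and by
    invariance and the Baire property a generic such point lies both in A and in
    its complement. *)
Lemma zero_one_law (I : Type) (g : I -> T -> T) A : baire_space T ->
  (forall i, continuous (g i)) -> (forall i, involutive (g i)) ->
  (forall U V, open U -> open V -> U !=set0 -> V !=set0 ->
     exists i x, U x /\ V (g i x)) ->
  (forall i x, A (g i x) <-> A x) ->
  baire_property A -> comeager A \/ comeager (~` A).
Proof.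
move=> bT cg gg tr iA bA; have [U oU AU] := bA.
have [W oW AW] := baire_propertyC bA.
have [[u Uu]|U0] := pselect (U !=set0); last first.
  by right; apply: filterS AU => x AUx /AUx Ux; apply: U0; exists x.
have [[w Ww]|W0] := pselect (W !=set0); last first.
  left; apply: filterS AW => x AWx; apply: contrapT => /AWx Wx.
  by apply: W0; exists x.
exfalso; have [i [x [Ux Wx]]] := tr _ _ oU oW (ex_intro _ u Uu) (ex_intro _ w Ww).
have gO V : open V -> open (g i @^-1` V) by move/continuousP: (cg i); apply.
(* g i is a homeomorphism, being its own inverse. *)
have gC B : comeager B -> comeager (g i @^-1` B).
  move=> [V oV VB]; exists (fun n => g i @^-1` V n); last by move=> y Vy; exact: VB.
  move=> n; have [oVn dVn] := oV n; split; first exact: gO.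
  move=> O [y Oy] oO; have [|z [Oz Vz]] := dVn (g i @^-1` O) _ (gO _ oO).
    by exists (g i y); rewrite /= gg.
  by exists (g i z); split => //; rewrite /= gg.
have [||y [[Uy Wy] [AUy AWy]]] :=
  bT _ (filterI AU (gC _ AW)) (U `&` g i @^-1` W).
- by exists x.
- exact/openI/gO.
by have /AWy := Wy; apply; apply/iA/AUy.
Qed.

End Comeager.

(** By regularity there are nonempty open sets W n, starting from V, such that the
    closure of W n.+1 lies in W n and in the n-th dense open set; compactness
    provides a point in all of them. *)
Lemma compact_hausdorff_baire (T : topologicalType) :
  compact [set: T] -> hausdorff_space T -> baire_space T.
Proof.
move=> cT hT A [U oU UA] V V0 oV.
pose S := {W : set T | open W /\ W !=set0}.
have step (n : nat) (W : S) : {W' : S | closure (sval W') `<=` sval W `&` U n}.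
  apply/cid; case: W => W [oW W0] /=; have [oUn dUn] := oU n.
  have [x [Wx Ux]] := dUn _ W0 oW.
  have nWU : nbhs x (W `&` U n) by apply: open_nbhs_nbhs; split=> //; exact: openI.
  have [B Bx BWU] := compact_regular hT cT filterT nWU.
  have B0 : open B° /\ B° !=set0 by split; [exact: open_interior|exists x].
  exists (exist _ B° B0) => /=; apply: subset_trans BWU.
  by apply: closureS; exact: interior_subset.
pose W := fix W n : S :=
  if n is m.+1 then sval (step m (W m)) else exist _ V (conj oV V0).
have Wn n : closure (sval (W n.+1)) `<=` sval (W n) `&` U n := svalP (step n (W n)).
have WS n : sval (W n.+1) `<=` sval (W n).
  by move=> x /subset_closure /Wn[].
have WD m n : (m <= n)%N -> sval (W n) `<=` sval (W m).
  move/subnK<-; elim: (n - m)%N => //= k IHk; exact: subset_trans (WS _) IHk.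
pose F := [set B | exists n, sval (W n) `<=` B].
have FF : ProperFilter F.
  split; first by case=> n; have [_ [x Wx]] := svalP (W n) => /(_ x Wx).
  split=> [|B C [m mB] [n nC]|B C BC [n nB]]; first by exists 0%N.
    exists (maxn m n) => x Wx; split.
      by apply/mB/(WD m (maxn m n)) => //; exact: leq_maxl.
    by apply/nC/(WD n (maxn m n)) => //; exact: leq_maxr.
  by exists n; exact: subset_trans BC.
have [|x [_ clx]] := cT F FF; first by exists 0%N.
have Wx n : closure (sval (W n)) x by move=> B Bx; apply: clx => //; exists n.
exists x; split; first by have /Wn[] := Wx 1%N.
by apply: UA => n _; have /Wn[] := Wx n.+1.
Qed.

(** The balls with centers in a countable dense set and radii 1 / (n + 1). *)
Lemma separable_metric_separating (R : realType) (P : metricType R) :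
  separable_space P -> exists B : nat * nat -> set P,
    (forall j, open (B j)) /\
    forall x y, (forall j, B j x -> B j y) -> x = y.
Proof.
move=> [D cD dD]; have /pfcard_geP[D0|[h]] := cD.
  exists (fun=> setT); split=> [_|x y _]; first exact: openT.
  have [||z [_]] := dD setT; [by exists x|exact: openT|by rewrite D0].
exists (fun j => (ball (h j.1) (j.2.+1%:R^-1 : R))°).
split=> [j|x y xy]; first exact: open_interior.
have [//|xNy] := eqVneq x y; exfalso.
have r0 : (0 < mdist x y)%R by rewrite mdist_gt0.
have [n] : exists n : nat, (0 + n.+1%:R^-1 < mdist x y / 2 :> R)%R.
  by apply: ltr_add_invr; rewrite divr_gt0.
rewrite add0r; set e := (n.+1%:R^-1 : R)%R => er.
have e0 : (0 < e)%R by rewrite invr_gt0.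
have e20 : (0 < e / 2)%R by rewrite divr_gt0.
have [||d [xd Dd]] := dD (ball x (e / 2)%R)°; last 1 first.
- move: xd => /interior_subset xd; have [m _ hm] := @surj _ _ _ _ h d Dd.
  have hx : (ball d e)° x.
    apply: filterS (nbhsx_ballx x (e / 2)%R e20) => z xz.
    rewrite [e](splitr e); apply: ball_triangle xz.
    exact: ball_sym.
  have := xy (m, n); rewrite /= hm => /(_ hx) /interior_subset dy.
  have := ball_triangle xd dy; rewrite ballEmdist /=.
  by apply/negP; rewrite -leNgt -/e; move: (mdist x y : R) er => r er; lra.
- by exists x; apply: nbhsx_ballx.
- exact: open_interior.
Qed.

(** Countably many open sets B j separate the points of P, and the zero-one law
    decides generically whether F x lies in B j; so all generic values of F lie
    in the same sets B j. *)
Lemma generically_constant (R : realType) (T : topologicalType) (I : Type)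
    (g : I -> T -> T) (P : metricType R) (F : T -> P) : baire_space T ->
  [set: T] !=set0 ->
  (forall i, continuous (g i)) -> (forall i, involutive (g i)) ->
  (forall U V, open U -> open V -> U !=set0 -> V !=set0 ->
     exists i x, U x /\ V (g i x)) ->
  separable_space P -> (forall i x, F (g i x) = F x) ->
  (forall U, open U -> baire_property (F @^-1` U)) ->
  exists p, \forall x \near @comeager T, F x = p.
Proof.
move=> bT T0 cg gg tr sP Fg FU.
have [B [oB sepB]] := separable_metric_separating sP.
pose E j x := B j (F x) <-> comeager (F @^-1` B j).
have : comeager [set x | forall j, E j x].
  apply: comeager_forall => j.
  have [||cB|cNB] := @zero_one_law _ _ g (F @^-1` B j) bT cg gg tr; last 2 first.
  - by apply: filterS (cB) => x Bx; split.
  - apply: filterS (cNB) => x nBx; split=> [//|cB].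
    by have [y [_ []]] := bT _ (filterI cB cNB) _ T0 openT.
  - by move=> i x; rewrite /preimage /= Fg.
  - exact: FU.
move=> cE; have [x0 [_ Ex0]] := bT _ cE _ T0 openT.
exists (F x0); apply: filterS cE => x Ex.
by apply: sepB => j Bx; apply: (proj2 (Ex0 j)); apply: (proj1 (Ex j)).
Qed.

(** * Products of copies of bool and the Cantor space *)

Section Product.
Variable I : eqType.
Implicit Types (x y : {ptws I -> bool}).

Lemma nbhs_cylinder x U :
  nbhs x U <-> exists l : seq I, forall y, {in l, y =1 x} -> U y.
Proof.
pose F : set_system {ptws I -> bool} :=
  [set V | exists l : seq I, forall y, {in l, y =1 x} -> V y].
have near_eq i : nbhs x [set y | y i = x i].
  exact: (@proj_continuous I (fun=> bool) i x _ (discrete_set1 _)).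
split; last first.
  move=> [l lU].
  suff : nbhs x [set y : {ptws I -> bool} | {in l, y =1 x}] by apply: filterS.
  elim: {lU} l => [|i l IHl].
    by apply: filterS filterT => y _ i; rewrite in_nil.
  apply: filterS2 IHl (near_eq i) => y yl yi j.
  by rewrite in_cons => /predU1P[->|/yl].
have FF : Filter F.
  split=> [|V W [l lV] [m mW]|V W VW [l lV]]; first by exists [::].
    exists (l ++ m) => y ylm; split; [apply: lV|apply: mW] => i il; apply: ylm.
      by rewrite mem_cat il.
    by rewrite mem_cat il orbT.
  by exists l => y /lV /VW.
suff : F --> x by apply.
apply/(@cvg_sup _ _ _ F x FF) => i V.
rewrite (@nbhsE (initial_topology (fun f : {ptws I -> bool} => f i))).
move=> -[W [[Q _ QW] Wx] WV].
exists [:: i] => y yx; apply: WV; rewrite -QW /=.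
by move: Wx; rewrite -QW /= yx// mem_head.
Qed.

End Product.

(** The open sets of a countable power of bool are countable unions of cylinders,
    so that the Baire property needs checking on coordinates only. *)
Lemma baire_property_product (T : topologicalType) (I : countType)
    (f : T -> {ptws I -> bool}) :
  (forall i, baire_property [set x | f x i]) ->
  forall O, open O -> baire_property (f @^-1` O).
Proof.
move=> bf O oO.
pose C (s : seq (I * bool)) x := forall j : 'I_(size s),
  let p := tnth (in_tuple s) j in f x p.1 = p.2.
pose Q s x := (forall y : {ptws I -> bool},
  {in s, forall p, y p.1 = p.2} -> O y) /\ C s x.
have bE (p : I * bool) : baire_property [set x | f x p.1 = p.2].
  case: p => i [] /=; first exact: bf.
  rewrite (_ : mkset _ = ~` [set x | f x i]); first exact/baire_propertyC/bf.
  by apply/seteqP; split=> x /=; [move->|move/negP/negbTE].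
rewrite (_ : _ @^-1` _ = [set x | exists s, Q s x]).
  apply: baire_property_exists => s.
  have bC : baire_property (C s).
    by apply: baire_property_forall => j; exact: bE.
  have [sO|nsO] := pselect (forall y : {ptws I -> bool},
      {in s, forall p, y p.1 = p.2} -> O y).
    by rewrite (_ : Q s = C s)//; apply/seteqP; split=> x; [case|].
  rewrite (_ : Q s = set0); last by apply/seteqP; split=> x // [/nsO].
  exact/baire_property_open/open0.
apply/seteqP; split=> x /=.
  move=> Ofx; have /nbhs_cylinder[l lO] := open_nbhs_nbhs (conj oO Ofx).
  exists [seq (i, f x i) | i <- l]; split.
    by move=> y yl; apply: lO => i il; apply: (yl (i, f x i)); exact: map_f.
  move=> j /=; move: (mem_tnth j (in_tuple [seq (i, f x i) | i <- l])).
  by case/mapP => i _ ->.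
move=> [s [sO sx]]; apply: sO => p /(tnthP (in_tuple s))[j ->]; exact: sx.
Qed.

(** The flips are a countable family of homeomorphisms whose orbits are the
    classes of sequences that agree up to finitely many places. *)
Definition flip (l : seq nat) (x : cantor_space) : cantor_space :=
  fun n => x n (+) (n \in l).

Lemma flipK l : involutive (flip l).
Proof. by move=> x; apply/funext => n; rewrite /flip addbK. Qed.

Lemma flip_continuous l : continuous (flip l).
Proof.
move=> x U /nbhs_cylinder[m mU]; apply/nbhs_cylinder; exists m => y yx.
by apply: mU => n nm; rewrite /flip yx.
Qed.

Lemma flip_transitive (U V : set cantor_space) : open U -> open V ->
  U !=set0 -> V !=set0 -> exists l x, U x /\ V (flip l x).
Proof.
move=> oU oV [x Ux] [y Vy].
have /nbhs_cylinder[m mV] := open_nbhs_nbhs (conj oV Vy).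
exists [seq n <- m | x n != y n], x; split=> //; apply: mV => n nm.
by rewrite /flip mem_filter nm andbT; case: (x n) (y n) => [] [].
Qed.

Lemma cantor_space_baire : baire_space cantor_space.
Proof.
exact: compact_hausdorff_baire cantor_space_compact cantor_space_hausdorff.
Qed.

Lemma cantor_comeagerC1 (A : set cantor_space) :
  (forall x y, A x -> A y -> x = y) -> comeager (~` A).
Proof.
move=> A1; have [[x Ax]|A0] := pselect (A !=set0); last first.
  by apply: filterS filterT => x _ Ax; apply: A0; exists x.
have -> : A = [set x] by apply/seteqP; split=> [y /A1/(_ Ax)|y ->].
apply: comeager_open_dense.
  apply: closed_openC; apply: accessible_closed_set1.
  exact/hausdorff_accessible/cantor_space_hausdorff.
move=> U U0 oU; have /perfectTP_ex/(_ U oU U0) := cantor_perfect.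
move=> [y [z [Uy Uz yz]]].
have [yx|yx] := eqVneq y x; last by exists y; split=> //; exact/eqP.
by exists z; split=> //= zx; move: yz; rewrite yx zx eqxx.
Qed.

(** * Subgroups as marked groups *)

HB.instance Definition _ (I : countType) := [Countable of free_group I by <:].

Lemma subgroup_closure_lift (H : groupType) n (a : 'I_n -> H) :
  subgroup_closure (range a) = range (fg_lift a).
Proof.
have := subgroup_closureP (range a); set S := subgroup_closure _ => Scl.
apply/seteqP; split.
  apply: smallest_sub; last first.
    by move=> _ [i _ <-]; exists (fg_gen i); rewrite ?fg_lift_gen.
  split; first by apply/mem_set; exists 1; rewrite ?gmulf1.
  move=> _ _ /set_mem[v _ <-] /set_mem[w _ <-]; apply/mem_set.
  by exists (v / w); rewrite ?gmulfF.
move=> _ [w _ <-]; rewrite /fg_lift; apply: set_mem.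
elim: (word w) => [|l u IHu] /=; first by case: Scl.
have Sl : a l.1 \in S by apply/mem_set; apply: sub_gen_smallest; exists l.1.
by apply: (group_closedM Scl) IHu; case: l.2 => //; exact: (group_closedV Scl).
Qed.

(** First isomorphism theorem: the marked group with kernel that of fg_lift a is
    the subgroup of H generated by a. *)
Lemma marking_ker_embedding (H : groupType) n (a : 'I_n -> H) :
  exists f : UMagmaMorphism.type (marked_quotient (marking_ker a)) H,
    injective f /\ forall w, f (quotient_pi (marking_ker a) w) = fg_lift a w.
Proof.
set N := marking_ker a.
have NE v w : quotient_pi N v = quotient_pi N w <-> fg_lift a v = fg_lift a w.
  rewrite quotient_pi_eq /= /marking_ker_pred gmulfM gmulfV /=; split=> [/eqP|->].
    by move/mulg1_eq; rewrite invgK.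
  by rewrite mulVg.
pose f (u : marked_quotient N) := fg_lift a (repr u).
have fE w : f (quotient_pi N w) = fg_lift a w.
  by apply/NE; rewrite /quotient_pi reprK.
have fM : {morph f : u v / u * v}.
  move=> u v; have [x ->] := quotient_pi_surj u; have [y ->] := quotient_pi_surj v.
  by rewrite -gmulfM !fE gmulfM.
have f1 : f 1 = 1 by apply: (mulgI (f 1)); rewrite -fM !mulg1.
exists (HB.pack_for (UMagmaMorphism.type (marked_quotient N) H) f
  (isUMagmaMorphism.Build (marked_quotient N) H f (f1, fM))).
split=> [u v /=|]; last exact: fE.
have [x ->] := quotient_pi_surj u; have [y ->] := quotient_pi_surj v.
by rewrite !fE => /NE.
Qed.

Lemma isomorphic_range (G1 G2 H : groupType) (f1 : UMagmaMorphism.type G1 H)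
    (f2 : UMagmaMorphism.type G2 H) :
  injective f1 -> injective f2 -> range f1 = range f2 -> isomorphic G1 G2.
Proof.
move=> i1 i2 r12.
have /(_ _)/cid-/all_sig[g gE] x : exists y, f2 y = f1 x.
  by have [y _ <-] : range f2 (f1 x); [rewrite -r12; exists x|exists y].
have /(_ _)/cid-/all_sig[h hE] y : exists x, f1 x = f2 y.
  by have [x _ <-] : range f1 (f2 y); [rewrite r12; exists y|exists x].
have gM : {morph g : x y / x * y}.
  by move=> x y; apply: i2; rewrite gE !gmulfM !gE.
exists (HB.pack_for {multiplicative G1 -> G2} g (isMultiplicative.Build G1 G2 g gM)).
by exists h => x /=; [apply: i1; rewrite hE gE|apply: i2; rewrite gE hE].
Qed.

(** Both marked groups embed into H, onto the same subgroup. *)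
Lemma marking_ker_isomorphic (H : groupType) n (a b : 'I_n -> H) :
  subgroup_closure (range a) = subgroup_closure (range b) ->
  isomorphic (marked_quotient (marking_ker a)) (marked_quotient (marking_ker b)).
Proof.
have rangeE m (c : 'I_m -> H) (f : UMagmaMorphism.type _ H) :
    (forall w, f (quotient_pi (marking_ker c) w) = fg_lift c w) ->
    range f = range (fg_lift c).
  move=> fE; apply/seteqP; split=> _ [u _ <-].
    by have [w ->] := quotient_pi_surj u; exists w; rewrite ?fE.
  by exists (quotient_pi (marking_ker c) u); rewrite ?fE.
rewrite !subgroup_closure_lift => ab.
have [f [fi /rangeE fr]] := marking_ker_embedding a.
have [g [gi /rangeE gr]] := marking_ker_embedding b.
by apply: (isomorphic_range fi gi); rewrite fr gr.
Qed.

Lemma isomorphic_embedding (G H : groupType) : isomorphic G H ->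
  exists f : UMagmaMorphism.type G H, injective f.
Proof.
move=> [f /bij_inj fi].
have f1 : f 1 = 1 by apply/(mulgI (f 1)); rewrite -gmulfM !mulg1.
by exists (HB.pack_for (UMagmaMorphism.type G H)
  (Multiplicative.sort f) (isUMagmaMorphism.Build G H f (f1, @gmulfM _ _ f))).
Qed.

(** With [isomorphic_embedding], this shows that a marked group isomorphic to H is
    given by a finite tuple of elements of H; this bounds the number of marked
    groups in an isomorphism class. *)
Lemma embedding_marking_ker (H : groupType) n (N : marked_group n)
    (f : UMagmaMorphism.type (marked_quotient N) H) :
  injective f -> N = marking_ker (f \o marked_gen N).
Proof.
move=> fi; rewrite -[LHS]marking_ker_quotient; apply/val_inj/funext => w /=.
by rewrite /marking_ker_pred -(fg_lift_comp f) (gmulf_eq1 _ fi).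
Qed.

(** K contains the images of all commutators, and hence lies over the derived
    subgroup of G modulo its center, while commutators of elements of K are
    central. *)
Lemma center_by_metabelian_embedding (G H : groupType)
    (f : UMagmaMorphism.type G H) (K : set H) : injective f ->
  group_closed [in K] -> (forall x y, K [~ f x, f y]) ->
  (forall x y z, K (f x) -> K (f y) -> commute [~ f x, f y] (f z)) ->
  center_by_metabelian G.
Proof.
move=> fi Kcl KR KZ.
pose pi : UMagmaMorphism.type G (quotient_group (Defs.center G)) :=
  quotient_pi (Defs.center G).
have derK : derived_subgroup (G := quotient_group (Defs.center G)) `<=`
    [set pi x | x in f @^-1` K].
  apply: smallest_sub; last first.
    move=> _ [u [v ->]]; have [x ->] := quotient_pi_surj u.
    have [y ->] := quotient_pi_surj v; exists [~ x, y]; rewrite ?gmulfR//.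
    by rewrite /preimage /= gmulfR; exact: KR.
  case: Kcl => K1 KF; split.
    apply/mem_set; exists 1; rewrite ?gmulf1 // /preimage /= gmulf1.
    exact: set_mem.
  move=> _ _ /set_mem[x Kx <-] /set_mem[y Ky <-]; apply/mem_set.
  exists (x / y); last by rewrite gmulfF.
  by rewrite /preimage /= gmulfF; apply/set_mem/KF; exact: mem_set.
move=> _ _ /derK[x Kx <-] /derK[y Ky <-].
rewrite /commute -!gmulfM; apply/esym/quotient_pi_eq; apply/asboolP => z.
have -> : (y * x)^-1 * (x * y) = [~ x, y] by rewrite commgEl /conjg invgM !mulgA.
by apply: fi; rewrite [LHS]gmulfM [RHS]gmulfM gmulfR; exact: KZ.
Qed.

(** * The group of permutations of a type *)

Record permutation (X : Type) := Permutation {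
  perm_fun :> X -> X;
  perm_inv : X -> X;
  perm_funK : cancel perm_fun perm_inv;
  perm_invK : cancel perm_inv perm_fun
}.

Section Permutations.
Variable X : Type.
Implicit Types g h : permutation X.

Lemma permutation_ext g h : g =1 h -> g = h.
Proof.
case: g h => [g g' gK g'K] [h h' hK h'K] /= /funext gh; subst h.
have g'h' : g' = h' by apply/funext => x; rewrite -{1}[x]h'K gK.
by subst h'; congr Permutation; exact: Prop_irrelevance.
Qed.

HB.instance Definition _ := gen_eqMixin (permutation X).
HB.instance Definition _ := gen_choiceMixin (permutation X).

Definition permutation_one := @Permutation X id id (fun=> erefl) (fun=> erefl).
Definition permutation_mul g h :=
  Permutation (can_comp (@perm_funK X g) (@perm_funK X h))
    (can_comp (@perm_invK X h) (@perm_invK X g)).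
Definition permutation_inv g := Permutation (@perm_invK X g) (@perm_funK X g).

Lemma permutation_mulA : associative permutation_mul.
Proof. by move=> f g h; exact: permutation_ext. Qed.
Lemma permutation_mul1g : left_id permutation_one permutation_mul.
Proof. by move=> g; exact: permutation_ext. Qed.
Lemma permutation_mulg1 : right_id permutation_one permutation_mul.
Proof. by move=> g; exact: permutation_ext. Qed.
Lemma permutation_mulVg :
  left_inverse permutation_one permutation_inv permutation_mul.
Proof. by move=> g; apply: permutation_ext => x; exact: perm_funK. Qed.
Lemma permutation_mulgV :
  right_inverse permutation_one permutation_inv permutation_mul.
Proof. by move=> g; apply: permutation_ext => x; exact: perm_invK. Qed.

HB.instance Definition _ := isGroup.Build (permutation X)
  permutation_mulA permutation_mul1g permutation_mulg1
  permutation_mulVg permutation_mulgV.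

Lemma permM g h x : (g * h) x = g (h x). Proof. by []. Qed.
Lemma permK g x : g^-1 (g x) = x. Proof. exact: perm_funK. Qed.
Lemma permVK g x : g (g^-1 x) = x. Proof. exact: perm_invK. Qed.
Lemma perm_inj g : injective g. Proof. exact: can_inj (permK g). Qed.

End Permutations.

(** * The groups G_c *)

Local Notation state := ((int -> bool) * bool)%type.
Implicit Types (u v m : int -> bool) (p : state) (c : cantor_space).

Definition xorf u v : int -> bool := fun i => u i (+) v i.
Definition shift (k : int) v : int -> bool := fun i => v (i + k)%R.

Lemma shift_stateK : cancel
  (fun p : state => (shift 1 p.1, p.2)) (fun p => (shift (-1) p.1, p.2)).
Proof.
by case=> v w; congr pair; apply/funext => i; rewrite /shift /= subrK.
Qed.
Lemma shift_stateVK : cancel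
  (fun p : state => (shift (-1) p.1, p.2)) (fun p => (shift 1 p.1, p.2)).
Proof.
by case=> v w; congr pair; apply/funext => i; rewrite /shift /= addrK.
Qed.
Definition shift_perm : permutation state :=
  Permutation shift_stateK shift_stateVK.

Lemma translateK m : involutive (fun p : state => (xorf p.1 m, p.2)).
Proof. by case=> v w; congr pair; apply/funext => i; rewrite /xorf /= addbK. Qed.
Definition translation m : permutation state :=
  Permutation (translateK m) (translateK m).

Lemma twistK : involutive (fun p : state => (p.1, p.2 (+) p.1 0%R)).
Proof. by case=> v w; rewrite /= addbK. Qed.
Definition twist : permutation state := Permutation twistK twistK.

Definition delta (n : nat) : int -> bool := fun i => i == n.
Definition extend c : int -> bool := fun i => if i is Posz n then c n else false.

(** The permutations t, e, f and b, in this order. *)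
Definition generator c (i : 'I_4) : permutation state :=
  match val i with
  | 0%N => shift_perm
  | 1%N => translation (delta 0)
  | 2%N => twist
  | _ => translation (extend c)
  end.

(** Over F_2 a function is affine if and only if it preserves sums of three
    terms. *)
Definition affine (q : (int -> bool) -> bool) : Prop :=
  forall u v x, q (xorf (xorf u v) x) = q u (+) q v (+) q x.

(** The exponent k is additive ([acts_affinelyM]), so it vanishes on commutators. *)
Definition acts_affinely (k : int) (h : permutation state) : Prop :=
  exists m q, affine q /\
    forall v w, h (v, w) = (xorf (shift k v) m, w (+) q v).

Lemma acts_affinely1 : acts_affinely 0 1.
Proof.
exists (fun=> false), (fun=> false); split=> // v w.
by rewrite addbF; congr pair; apply/funext => i; rewrite /xorf /shift addr0 addbF.
Qed.

Lemma acts_affinelyM k l g h :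
  acts_affinely k g -> acts_affinely l h -> acts_affinely (k + l) (g * h).
Proof.
move=> [m [q [qa gE]]] [m' [q' [q'a hE]]].
exists (xorf (shift k m') m), (fun v => q' v (+) q (xorf (shift l v) m')); split.
  move=> u v x; rewrite q'a.
  have -> : xorf (shift l (xorf (xorf u v) x)) m' =
      xorf (xorf (xorf (shift l u) m') (xorf (shift l v) m')) (xorf (shift l x) m').
    apply/funext => i; rewrite /xorf /shift.
    by case: (u _) (v _) (x _) (m' _) => [] [] [] [].
  rewrite qa; move: (q' u) (q' v) (q' x) (q _) (q _) (q _).
  by do 6!case.
move=> v w; rewrite permM hE gE addbA; congr pair; apply/funext => i.
by rewrite /xorf /shift addbA addrA.
Qed.

Lemma acts_affinelyV k h : acts_affinely k h -> acts_affinely (- k) h^-1.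
Proof.
move=> [m [q [qa hE]]].
have dq v x y : q v = q x (+) q y (+) q (xorf (xorf x y) v).
  by rewrite qa; move: (q v) (q x) (q y); do 3!case.
exists (shift (- k) m), (fun v => q (xorf (shift (- k) v) (shift (- k) m))); split.
  move=> u v x; rewrite -qa; congr q; apply/funext => i; rewrite /xorf /shift.
  by move: (u _) (v _) (x _) (m _); do 4!case.
move=> v w; apply: (@perm_inj _ h); rewrite permVK hE addbK; congr pair.
by apply/funext => i; rewrite /xorf /shift addrK addbK.
Qed.

Lemma acts_affinely_generator c i : exists k, acts_affinely k (generator c i).
Proof.
have tr m : acts_affinely 0 (translation m).
  exists m, (fun=> false); split=> // v w; rewrite addbF; congr pair.
  by apply/funext => j; rewrite /xorf /shift addr0.
case: i => [[|[|[|i]]] ilt].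
- exists 1%R, (fun=> false), (fun=> false); split=> // v w.
  by rewrite addbF; congr pair; apply/funext => j; rewrite /xorf addbF.
- by exists 0%R; exact: tr.
- exists 0%R, (fun=> false), (fun v => v 0%R); split=> // v w; congr pair.
  by apply/funext => j; rewrite /xorf /shift addr0 addbF.
- by exists 0%R; exact: tr.
Qed.

Lemma acts_affinely_lift c w : exists k, acts_affinely k (fg_lift (generator c) w).
Proof.
rewrite /fg_lift; elim: (word w) => [|l u [k IHu]] /=.
  by exists 0%R; exact: acts_affinely1.
have [j gj] := acts_affinely_generator c l.1.
case: l.2; eexists; apply: acts_affinelyM IHu; last exact: gj.
by apply: acts_affinelyV; exact: gj.
Qed.

Lemma acts_affinelyR k l g h :
  acts_affinely k g -> acts_affinely l h -> acts_affinely 0 [~ g, h].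
Proof.
move=> kg lh; rewrite (_ : 0 = - k + (- l + (k + l)))%R.
  by do !apply: acts_affinelyM => //; exact: acts_affinelyV.
by lia.
Qed.

(** The functions v |-> q v + q (v + m') and v |-> q' v + q' (v + m) are constant, q
    and q' being affine; their sum is the difference of g * h and h * g in the
    second coordinate. *)
Lemma commutator_vertical g h :
  acts_affinely 0 g -> acts_affinely 0 h ->
  exists b, forall p, [~ g, h] p = (p.1, p.2 (+) b).
Proof.
move=> [m [q [qa gE]]] [m' [q' [q'a hE]]].
pose o : int -> bool := fun=> false.
exists (q m' (+) q o (+) q' m (+) q' o) => -[v w].
apply: (@perm_inj _ (h * g)); rewrite -permM -commgC !permM /= !(gE, hE).
have s0 x : shift 0 x = x by apply/funext => i; rewrite /shift addr0.
have aE r x y : affine r -> r (xorf x y) = r x (+) r y (+) r o.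
  move=> ra; rewrite -ra; congr r; apply/funext => i; rewrite /xorf /o addbF.
  by [].
rewrite !s0 (aE q) // (aE q') //; congr pair.
  by apply/funext => i; rewrite /xorf addbAC.
by move: w (q _) (q _) (q _) (q' _) (q' _) (q' _); do 7!case.
Qed.

Lemma vertical_commute k (h z : permutation state) b :
  (forall p, h p = (p.1, p.2 (+) b)) ->
  acts_affinely k z -> commute h z.
Proof.
move=> hE [m [q [qa zE]]]; apply: permutation_ext => -[v w].
by rewrite !permM !(hE, zE) /= addbAC.
Qed.

Definition marked_family c : marked_group 4 := marking_ker (generator c).

Lemma center_by_metabelian_family (G : groupType) c :
  isomorphic G (marked_quotient (marked_family c)) -> center_by_metabelian G.
Proof.
move=> /isomorphic_embedding[e ei].
have [f [fi fE]] := marking_ker_embedding (generator c).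
have fei : injective (f \o e) by exact: inj_comp.
have aff x : exists k, acts_affinely k ((f \o e) x).
  rewrite /=; have [w ->] := quotient_pi_surj (e x); rewrite fE.
  exact: acts_affinely_lift.
apply: (@center_by_metabelian_embedding G _ (f \o e) (acts_affinely 0)) => //.
- split; first by apply/mem_set; exact: acts_affinely1.
  move=> x y /set_mem x0 /set_mem y0; apply/mem_set.
  rewrite -[0%R](addrN 0%R); apply: acts_affinelyM => //; exact: acts_affinelyV.
- move=> x y; have [k kx] := aff x; have [l ly] := aff y.
  exact: acts_affinelyR kx ly.
- move=> x y z x0 y0; have [b bE] := commutator_vertical x0 y0.
  by have [k kz] := aff z; exact: vertical_commute bE kz.
Qed.

Lemma shift_permX n p : (shift_perm ^+ n) p = (shift n p.1, p.2).
Proof.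
elim: n => [|n IHn].
  by case: p => v w; congr pair; apply/funext => i; rewrite /shift addr0.
rewrite expgS permM IHn /=; congr pair; apply/funext => i; rewrite /shift -addrA.
by congr (_ _); lia.
Qed.

(** The conjugates of e and f by t ^+ n give access to the coordinate n. *)
Lemma translation_conj n :
  translation (delta 0) ^ (shift_perm ^+ n) = translation (delta n).
Proof.
apply: permutation_ext => p; rewrite conjgE !permM.
apply: (@perm_inj _ (shift_perm ^+ n)); rewrite permVK !shift_permX /=.
congr pair; apply/funext => i; rewrite /xorf /shift /delta.
by congr (_ (+) _); apply/eqP/eqP; lia.
Qed.

Lemma twist_conj n p : (twist ^ (shift_perm ^+ n)) p = (p.1, p.2 (+) p.1 n).
Proof.
rewrite conjgE !permM; apply: (@perm_inj _ (shift_perm ^+ n)).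
by rewrite permVK !shift_permX /= /shift add0r.
Qed.

Lemma translation_twist_commute m n :
  commute (translation m) (twist ^ (shift_perm ^+ n)) <-> ~~ m n.
Proof.
split=> [tc|/negbTE mn].
  have : (translation m * twist ^ (shift_perm ^+ n)) (fun=> false, false) =
    (twist ^ (shift_perm ^+ n) * translation m) (fun=> false, false) by rewrite tc.
  rewrite [LHS]permM [RHS]permM !twist_conj => /(congr1 snd).
  by rewrite /= /xorf /= => <-.
apply: permutation_ext => -[v w].
by rewrite [LHS]permM [RHS]permM !twist_conj /= /xorf mn addbF.
Qed.

(** A word in t, f and b that is trivial exactly when the n-th term of c is 0. *)
Definition detector (n : nat) : free_group 'I_4 :=
  let x k lt_k4 := fg_gen (@Ordinal 4 k lt_k4) in
  [~ x 3%N isT, x 2%N isT ^ (x 0%N isT ^+ n)].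

Lemma detectorE c n : val (marked_family c) (detector n) = ~~ c n.
Proof.
rewrite /= /marking_ker_pred /detector gmulfR gmulfJ gmulfXn /= !fg_lift_gen.
apply/commgP/idP => [/translation_twist_commute //|cn].
exact/translation_twist_commute.
Qed.

Lemma marked_family_inj : injective marked_family.
Proof.
move=> c d cd; apply/funext => n; apply: negb_inj.
by rewrite -!detectorE cd.
Qed.

(** The translation by the indicator function of s is the product of the
    e ^ (t ^+ n), for the distinct n in s. *)
Lemma translation_closure c (s : seq nat) :
  subgroup_closure (range (generator c))
    (translation (extend (fun n => n \in s))).
Proof.
have := subgroup_closureP (range (generator c)); set S := subgroup_closure _ => Scl.
have Sg (i : 'I_4) : generator c i \in S.
  by apply/mem_set; apply: sub_gen_smallest; exists i.
have Sd n : translation (delta n) \in S.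
  rewrite -translation_conj; have St : shift_perm ^+ n \in S.
    elim: n => [|n IHn]; first by case: Scl.
    rewrite expgS; apply: (group_closedM Scl) => //.
    exact: (Sg (@Ordinal 4 0 isT)).
  rewrite conjgE; apply: (group_closedM Scl); first exact: (group_closedV Scl).
  by apply: (group_closedM Scl) => //; exact: (Sg (@Ordinal 4 1 isT)).
apply: set_mem; elim: s => [|n s IHs].
  rewrite (_ : translation _ = 1); first by case: Scl.
  apply: permutation_ext => -[v w]; congr pair; apply/funext => -[i|i]; exact: addbF.
have [ns|nns] := boolP (n \in s).
  rewrite (_ : (fun i => i \in n :: s) = (fun i => i \in s)) //.
  by apply/funext => i; rewrite in_cons; case: eqVneq => [->|].
rewrite (_ : translation _ =
  translation (extend (fun n => n \in s)) * translation (delta n)).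
  exact: (group_closedM Scl).
apply: permutation_ext => -[v w]; congr pair; apply/funext => -[i|i] /=.
  rewrite /xorf /delta /= eqz_nat in_cons; have [->|ni] /= := eqVneq i n.
    by rewrite (negbTE nns) addbF.
  by rewrite addbF.
by rewrite /xorf /delta /= !addbF.
Qed.

(** The two groups are generated by t, e, f and by translations that differ by a
    translation of finite support, so that they are the same group of
    permutations. *)
Lemma marked_family_flip s c :
  isomorphic (marked_quotient (marked_family (flip s c)))
    (marked_quotient (marked_family c)).
Proof.
apply: marking_ker_isomorphic.
have sub (d : cantor_space) : subgroup_closure (range (generator (flip s d))) `<=`
    subgroup_closure (range (generator d)).
  apply: smallest_sub; first exact: subgroup_closureP.
  have Scl := subgroup_closureP (range (generator d)).
  have Sg (i : 'I_4) : subgroup_closure (range (generator d)) (generator d i).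
    by apply: sub_gen_smallest; exists i.
  move=> _ [[[|[|[|k]]] k4] _ <-].
  - exact: (Sg (@Ordinal 4 0 isT)).
  - exact: (Sg (@Ordinal 4 1 isT)).
  - exact: (Sg (@Ordinal 4 2 isT)).
  rewrite (_ : generator _ _ = generator d (@Ordinal 4 3 isT) *
    translation (extend (fun n => n \in s))).
    apply/set_mem/(group_closedM Scl); apply/mem_set; first exact: Sg.
    exact: translation_closure.
  apply: permutation_ext => -[v w]; congr pair.
  apply/funext => -[i|i]; rewrite /xorf /=.
    by rewrite /flip addbAC addbA.
  by rewrite /xorf !addbF.
apply/seteqP; split; first exact: sub.
by have := @sub (flip s c); rewrite flipK.
Qed.

(** * The family of marked groups and the Baire property *)

(** Continuity at c for the topology of pointwise convergence on the states. *)
Definition coordinatewise_continuous c (p : cantor_space -> state) : Prop :=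
  (forall k, \forall d \near c, (p d).1 k = (p c).1 k) /\
  \forall d \near c, (p d).2 = (p c).2.

Lemma generator_continuous c (p : cantor_space -> state) i :
  coordinatewise_continuous c p ->
  coordinatewise_continuous c (fun d => generator d i (p d)) /\
  coordinatewise_continuous c (fun d => (generator d i)^-1 (p d)).
Proof.
move=> [p1 p2].
have tr (m : cantor_space -> int -> bool) :
    (forall k, \forall d \near c, m d k = m c k) ->
    coordinatewise_continuous c (fun d => translation (m d) (p d)).
  move=> mc; split=> [k|//]; apply: filterS2 (p1 k) (mc k) => d pk mk.
  by rewrite /= /xorf pk mk.
have ext k : \forall d \near c, extend d k = extend c k.
  case: k => n; last by apply: filterS filterT => d _.
  apply: (proj2 (@nbhs_cylinder nat c _)); exists [:: n] => d; apply.
  by rewrite mem_head.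
case: i => [[|[|[|k]]] k4].
- by split; split=> [k|//]; exact: p1.
- by split; apply: tr => k; apply: filterS filterT => d _.
- have tw : coordinatewise_continuous c (fun d => twist (p d)).
    by split=> //; apply: filterS2 p2 (p1 0%R) => d /= -> ->.
  by split.
- by split; exact: tr.
Qed.

Lemma state_ext (p q : state) : (forall k, p.1 k = q.1 k) -> p.2 = q.2 -> p = q.
Proof. by case: p q => [v b] [u a] /= /funext -> ->. Qed.

(** A nontrivial permutation changes some coordinate of some state, and this
    persists for nearby sequences. *)
Lemma marked_family_closed (w : free_group 'I_4) :
  closed [set c | val (marked_family c) w].
Proof.
have cont p c : coordinatewise_continuous c (fun d => fg_lift (generator d) w p).
  rewrite /fg_lift; elim: (word w) => [|l u IHu] /=.
    by split=> [k|]; apply: filterS filterT => d _.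
  by have [] := generator_continuous l.1 IHu; case: l.2.
rewrite -[X in closed X]setCK; apply: open_closedC; rewrite openE => c /negP/eqP cw.
have [p pw] : exists p : state, fg_lift (generator c) w p <> p.
  apply: contrapT => nex; apply: cw; apply: permutation_ext => p.
  by apply: contrapT => pw; apply: nex; exists p.
have moved (d : cantor_space) : fg_lift (generator d) w p <> p ->
    ~ val (marked_family d) w by move=> dp /eqP dw; apply: dp; rewrite dw.
have [c1 c2] := cont p c.
have [e2|n2] := eqVneq (fg_lift (generator c) w p).2 p.2; last first.
  apply: filterS c2 => d d2; apply: moved => dp.
  by move: n2; rewrite -d2 dp eqxx.
have [k nk] : exists k, (fg_lift (generator c) w p).1 k <> p.1 k.
  apply: contrapT => nex; apply/pw/state_ext => // k.
  by apply: contrapT => vk; apply: nex; exists k.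
by apply: filterS (c1 k) => d dk; apply: moved => dp; apply: nk; rewrite -dk dp.
Qed.

Definition family_class c : marked_groups :=
  (\pi_marked_groups (existT _ 4%N (marked_family c) : marked_sum))%qT.

Lemma family_class_iso c :
  isomorphic (group_of (family_class c)) (marked_quotient (marked_family c)).
Proof. exact: (group_of_pi (existT _ 4%N (marked_family c) : marked_sum)). Qed.

Lemma family_class_cbm c : cbm_groups (family_class c).
Proof. exact: center_by_metabelian_family (family_class_iso c). Qed.

Definition cbm_family c : cbm_groups := SigSub (mem_set (@family_class_cbm c)).

Lemma cbm_familyP c d : @isomorphism_on cbm_groups (cbm_family c) (cbm_family d) <->
  isomorphic (marked_quotient (marked_family c)) (marked_quotient (marked_family d)).
Proof.
rewrite /isomorphism_on /=; split=> cd.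
  apply: isomorphic_trans (family_class_iso d).
  exact: isomorphic_trans (isomorphic_sym (family_class_iso c)) cd.
apply: isomorphic_trans (isomorphic_sym (family_class_iso d)).
exact: isomorphic_trans (family_class_iso c) cd.
Qed.

(** By the definition of the topologies, an open set of marked groups is pulled
    back to an open set V of the power of bool indexed by the words in four
    letters. *)
Lemma cbm_family_baire (B : set cbm_groups) :
  <<s @open cbm_groups >> B -> baire_property (cbm_family @^-1` B).
Proof.
suff : <<s @open cbm_groups >> `<=`
  [set B | baire_property (cbm_family @^-1` B)] by apply.
apply: smallest_sub; first split.
- exact/baire_property_open/open0.
- by move=> A; rewrite /= setTD; exact: baire_propertyC.
- move=> A bA /=.
  rewrite (_ : _ @^-1` _ = [set c | exists n, (cbm_family @^-1` A n) c]).
    exact: baire_property_exists.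
  by apply/seteqP; split=> c /= => [[n _ An]|[n An]]; exists n.
move=> _ [U oU <-] /=.
have /sigT_openP/(_ 4%N)[V oV VU] :
  open (\pi_marked_groups%qT @^-1` U : set marked_sum) by [].
rewrite (_ : _ @^-1` _ = (fun c => val (marked_family c)) @^-1` V).
  apply: baire_property_product oV => w.
  rewrite -[X in baire_property X]setCK; apply/baire_propertyC/baire_property_open.
  by rewrite openC; exact: marked_family_closed.
apply/seteqP; split=> c /= Uc.
  have : (existT _ 4%N @^-1` (\pi_marked_groups%qT @^-1` U)) (marked_family c).
    by [].
  by rewrite -VU.
by have : (val @^-1` V) (marked_family c) by []; rewrite VU.
Qed.

(** An isomorphism from the d-th to the c-th group is determined by the images of
    the four generators, that is by a quadruple t of words, and d is determined
    by t. *)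
Lemma isomorphic_family_meager c :
  \forall d \near @comeager cantor_space,
    ~ isomorphic (marked_quotient (marked_family d))
        (marked_quotient (marked_family c)).
Proof.
pose b (t : {ffun 'I_4 -> free_group 'I_4}) i := quotient_pi (marked_family c) (t i).
have : comeager [set d | forall t, marked_family d <> marking_ker (b t)].
  apply: comeager_forall => t; apply: cantor_comeagerC1 => d e dt et.
  by apply: marked_family_inj; rewrite dt et.
apply: filterS => d dt /isomorphic_embedding[f fi].
have /(_ _)/cid-/all_sig[t tE] i :
    exists w, f (marked_gen _ i) = quotient_pi (marked_family c) w.
  exact: quotient_pi_surj.
apply: (dt [ffun i => t i]); rewrite {1}(embedding_marking_ker fi).
by congr marking_ker; apply/funext => i; rewrite /= /b ffunE tE.
Qed.

Theorem corollary1p6 (R : realType) :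
  ~ smooth R (@isomorphism_on cbm_groups).
Proof.
move=> [P [_ sP [f bf fE]]].
have [|||p fp] := @generically_constant R _ _ flip P (f \o cbm_family)
  cantor_space_baire _
  flip_continuous flipK flip_transitive sP.
- by exists (fun=> false).
- move=> s c; apply: (proj1 (fE _ _)); apply: (proj2 (cbm_familyP _ _)).
  exact: marked_family_flip.
- move=> U oU; apply: (@cbm_family_baire (f @^-1` U)); apply: bf.
  exact: sub_gen_smallest.
have cT : [set: cantor_space] !=set0 by exists (fun=> false).
have [c [_ fc]] := cantor_space_baire fp cT openT.
have [d [_ [fd]]] :=
  cantor_space_baire (filterI fp (isomorphic_family_meager c)) cT openT.
apply; apply: (proj1 (cbm_familyP _ _)); apply: (proj2 (fE _ _)).
exact: etrans fd (esym fc).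
Qed.
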